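(* A generalized bitopological space $(X,\mu_1,\mu_2)$ is pairwise $T_{\frac58}$ if and only if every subset $E$ of $X$ is pairwise $\lambda$-closed.
   Context: A generalized topology on a nonempty set $X$ is a collection $\mu$ of subsets of $X$ that contains $\emptyset$ and is closed under arbitrary unions ($X$ itself need not belong to $\mu$). Members of $\mu$ are called $\mu$-open and their complements $\mu$-closed. A generalized bitopological space (GBT-space) $(X,\mu_1,\mu_2)$ is a nonempty set $X$ with two generalized topologies $\mu_1,\mu_2$. The space is pairwise $T_{\frac58}$ if for any subset $P$ of $X$ and every $y\in X-P$ there exists a set $A_y$ containing $P$ and disjoint from $\{y\}$ such that $A_y$ is $\mu_i$-open for some $i\in\{1,2\}$ or $\mu_j$-closed for some $j\in\{1,2\}$. For $A\subset X$, $A_{\mu}^{\wedge}=\bigcap\{U\in\mu: A\subset U\}$ (equal to $X$ if no $\mu$-open set contains $A$); $A$ is a $\wedge_{\mu}$-set if $A=A_{\mu}^{\wedge}$. $A$ is pairwise $\lambda$-closed if $A=(F_1\cap F_2)\cap(L_1\cap L_2)$ where $F_1,F_2$ are respectively $\mu_1$-closed and $\mu_2$-closed and $L_1,L_2$ are respectively a $\wedge_{\mu_1}$-set and a $\wedge_{\mu_2}$-set. *)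

(* Defs.v *)
From mathcomp Require Import all_boot.
From mathcomp Require Import boolp classical_sets.

Set Implicit Arguments.
Unset Strict Implicit.
Unset Printing Implicit Defensive.

Local Open Scope classical_set_scope.

(* Unlike a topology, [mu] need not contain [setT]. *)
Definition generalized_topology (X : Type) (mu : set (set X)) : Prop :=
  mu set0 /\ forall F : set (set X), F `<=` mu -> mu (\bigcup_(U in F) U).

Record gbt_space := GBTSpace {
  gbt_carrier :> Type;
  gbt_nonempty : [set: gbt_carrier] !=set0;
  gbt_open1 : set (set gbt_carrier);
  gbt_open2 : set (set gbt_carrier);
  gbt_open1P : generalized_topology gbt_open1;
  gbt_open2P : generalized_topology gbt_open2 }.

Definition gt_closed (X : Type) (mu : set (set X)) (F : set X) : Prop :=
  mu (~` F).

Section GBT.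
Variable X : gbt_space.
Local Notation mu1 := (@gbt_open1 X).
Local Notation mu2 := (@gbt_open2 X).

Definition pairwise_T58 : Prop :=
  forall (P : set X) (y : X), (~` P) y ->
    exists A : set X, [/\ P `<=` A, A `&` [set y] = set0 &
      (mu1 A \/ mu2 A) \/ (gt_closed mu1 A \/ gt_closed mu2 A)].

End GBT.

(* The intersection of the empty family is [setT], so [wedge mu A] is the whole
   space when no member of [mu] contains [A]. *)
Definition wedge (X : Type) (mu : set (set X)) (A : set X) : set X :=
  \bigcap_(U in [set U | mu U /\ A `<=` U]) U.

Definition wedge_set (X : Type) (mu : set (set X)) (A : set X) : Prop :=
  A = wedge mu A.

Definition pairwise_lambda_closed (X : gbt_space) (A : set X) : Prop :=
  exists F1 F2 L1 L2 : set X,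
    [/\ gt_closed (@gbt_open1 X) F1, gt_closed (@gbt_open2 X) F2,
        wedge_set (@gbt_open1 X) L1, wedge_set (@gbt_open2 X) L2 &
        A = (F1 `&` F2) `&` (L1 `&` L2)].

(* Main.v *)
Require Import Defs.
From mathcomp Require Import all_boot.
From mathcomp Require Import boolp classical_sets.

(* A point outside [E] lies outside an open (resp. closed) set containing [E]
   exactly when it lies outside the wedge (resp. the closure) of [E], so the
   separation axiom says that every [E] is the intersection of its two closures
   and its two wedges. *)

Set Implicit Arguments.
Unset Strict Implicit.

Local Open Scope classical_set_scope.

Definition gt_closure (X : Type) (mu : set (set X)) (A : set X) : set X :=
  \bigcap_(F in [set F | gt_closed mu F /\ A `<=` F]) F.

(** By De Morgan, the complement of the closure is the union of the complements of the closed
    supersets of [A], all of them in [mu]. *)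
Lemma gt_closure_closed (X : Type) (mu : set (set X)) (A : set X) :
  generalized_topology mu -> gt_closed mu (gt_closure mu A).
Proof.
move=> [_ muU]; rewrite /gt_closed /gt_closure setC_bigcap -(bigcup_image _ _ id).
by apply: muU => _ [F [cF _] <-].
Qed.

Lemma subset_gt_closure (X : Type) (mu : set (set X)) (A : set X) :
  A `<=` gt_closure mu A.
Proof. by move=> x Ax F [_]; exact. Qed.

Lemma subset_wedge (X : Type) (mu : set (set X)) (A : set X) :
  A `<=` wedge mu A.
Proof. by move=> x Ax U [_]; exact. Qed.

(** Every open superset of [A] already contains [wedge mu A], so taking the wedge again removes
    nothing. *)
Lemma wedge_set_wedge (X : Type) (mu : set (set X)) (A : set X) :
  wedge_set mu (wedge mu A).
Proof.
apply/seteqP; split; first exact: subset_wedge.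
by move=> x wwx U [oU AU]; apply: wwx; split=> // z; apply.
Qed.

(** If every open superset of [L] contained [y], then [y] would lie in [wedge mu L], which is
    [L]. *)
Lemma wedge_set_separation (X : Type) (mu : set (set X)) (L : set X) (y : X) :
  wedge_set mu L -> ~ L y -> exists U, [/\ mu U, L `<=` U & ~ U y].
Proof.
move=> wL nLy; apply: contrapT => noU; apply: nLy; rewrite wL => U [oU LU].
by apply: contrapT => nUy; apply: noU; exists U.
Qed.

Theorem theorem5p5 (X : gbt_space) :
  pairwise_T58 X <-> forall E : set X, pairwise_lambda_closed E.
Proof.
split=> [T58 E|lambdaX P y nPy].
  exists (gt_closure (@gbt_open1 X) E), (gt_closure (@gbt_open2 X) E).
  exists (wedge (@gbt_open1 X) E), (wedge (@gbt_open2 X) E).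
  split; [exact: gt_closure_closed (@gbt_open1P X)
    | exact: gt_closure_closed (@gbt_open2P X)
    | exact: wedge_set_wedge | exact: wedge_set_wedge |].
  apply/seteqP; split=> [x Ex|y [[C1y C2y] [W1y W2y]]].
    by split; split; [exact: subset_gt_closure | exact: subset_gt_closure
      | exact: subset_wedge | exact: subset_wedge].
  (* The separating set [A] takes part in one of the four intersections that contain [y], so [y] is
     in [A], a contradiction. *)
  apply: contrapT => nEy; have [A [EA /disjoints_subset Ay oA]] := T58 E y nEy.
  suff {}/Ay : A y by apply.
  by case: oA => -[oA|oA]; [exact: W1y | exact: W2y | exact: C1y | exact: C2y].
have [F1 [F2 [L1 [L2 [cF1 cF2 wL1 wL2 PE]]]]] := lambdaX P.
(* Since [y] is outside [P], it misses one of [F1], [F2], [L1], [L2]; each case supplies a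
   separating set. *)
have sep A : P `<=` A -> ~ A y ->
    (@gbt_open1 X A \/ @gbt_open2 X A) \/
    (gt_closed (@gbt_open1 X) A \/ gt_closed (@gbt_open2 X) A) ->
    exists A : set X, [/\ P `<=` A, A `&` [set y] = set0 &
      (@gbt_open1 X A \/ @gbt_open2 X A) \/
      (gt_closed (@gbt_open1 X) A \/ gt_closed (@gbt_open2 X) A)].
  move=> PA nAy oA; exists A; split=> //.
  by apply/disjoints_subset => z Az zy; apply: nAy; rewrite -zy.
have [F1y|nF1y] := pselect (F1 y); last first.
  by apply: (sep F1) => //; [rewrite PE => z [[]] | right; left].
have [F2y|nF2y] := pselect (F2 y); last first.
  by apply: (sep F2) => //; [rewrite PE => z [[]] | right; right].
(* Unlike [F1] and [F2], the set [L1] cannot serve as the witness itself, since it need not be open;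
   an open superset of it that omits [y] does. *)
have [L1y|/(wedge_set_separation wL1)[U [oU LU nUy]]] := pselect (L1 y); last first.
  by apply: (sep U) => //; [rewrite PE => z [_ [/LU]] | left; left].
have [L2y|/(wedge_set_separation wL2)[U [oU LU nUy]]] := pselect (L2 y); last first.
  by apply: (sep U) => //; [rewrite PE => z [_ [_ /LU]] | left; right].
by case: nPy; rewrite PE.
Qed.
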